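(* For every integer $n\geq 1$, $$cr(K_{n,n}-nK_2)\leq \left\lfloor\frac{n}{2}\right\rfloor\left\lfloor\frac{n-1}{2}\right\rfloor\left\lfloor\frac{n-2}{2}\right\rfloor\left\lfloor\frac{n-3}{2}\right\rfloor .$$
   Context: The crossing number $cr(G)$ of a graph $G$ is the smallest number of pairwise crossings of edges among all drawings of $G$ in the plane. The graph $K_{n,n}-nK_2$ (the complete bipartite graph minus a perfect matching) has vertex set $\{a_i,b_i : 0\leq i\leq n-1\}$ and edge set $\{(a_i,b_j) : 0\leq i\neq j\leq n-1\}$. *)

(* Defs.v *)
From HB Require Import structures.
From mathcomp Require Import all_boot all_order all_algebra.
From mathcomp Require Import all_classical all_reals all_analysis.
From mathcomp Require Import ring lra.

Set Implicit Arguments.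
Unset Strict Implicit.
Unset Printing Implicit Defensive.

Import Order.TTheory GRing.Theory Num.Theory.
Import numFieldNormedType.Exports.

Local Open Scope classical_set_scope.
Local Open Scope card_scope.
Local Open Scope ring_scope.

Record sgraph := SGraph {
  vertex : finType;
  adj : rel vertex;
  adj_sym : symmetric adj;
  adj_irr : irreflexive adj }.

Definition edges (G : sgraph) : {set {set vertex G}} :=
  [set E | [exists x, exists y, adj x y && (E == [set x; y]%SET)]]%SET.

(* The values of [arc] on sets that are not edges are irrelevant. An arc is
   parametrised in either direction, hence the set equality [arc_ends]. *)
Record drawing (R : realType) (G : sgraph) := Drawing {
  point : vertex G -> R * R;
  arc : {set vertex G} -> R -> R * R;
  point_inj : injective point;
  arc_continuous : forall E, E \in edges G ->
    {within `[0, 1], continuous (arc E)};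
  arc_simple : forall E, E \in edges G -> set_inj `[0, 1] (arc E);
  arc_ends : forall E, E \in edges G ->
    arc E @` [set 0; 1] = point @` [set` E];
  arc_avoids : forall E, E \in edges G ->
    forall t v, t \in `]0, 1[ -> arc E t <> point v }.

(* A crossing is an unordered pair of distinct edges together with a common
   interior point of their arcs: a point interior to m arcs contributes
   'C(m, 2) crossings, two adjacent edges may cross, and a point where two arcs
   merely touch is counted as well. *)
Definition crossings (R : realType) (G : sgraph) (D : drawing R G) :
    set ({set {set vertex G}} * (R * R)) :=
  [set c | exists E F : {set vertex G},
    [/\ E \in edges G, F \in edges G, E != F, c.1 = [set E; F]%SET &
        (arc D E @` `]0, 1[ `&` arc D F @` `]0, 1[) c.2]].

Definition drawable_with (R : realType) (G : sgraph) (k : nat) : Prop :=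
  exists D : drawing R G, crossings D #= `I_k.

Section DrawingExists.
Variables (R : realType) (G : sgraph).

Lemma edgesP (E : {set vertex G}) :
  E \in edges G ->
  exists x y : vertex G, [/\ x != y & E = [set x; y]%SET].
Proof.
rewrite inE => /existsP[x /existsP[y /andP[xy /eqP ->]]].
exists x, y; split => //.
by apply/eqP => exy; rewrite exy adj_irr in xy.
Qed.

Definition abscissa (v : vertex G) : R := (enum_rank v : nat)%:R.

Lemma abscissa_inj : injective abscissa.
Proof.
move=> u v /eqP; rewrite eqr_nat => /eqP uv.
by apply: enum_rank_inj; apply: val_inj.
Qed.

(* Vertices on the parabola y = x^2, edges drawn as chords. *)
Definition parabola (v : vertex G) : R * R := (abscissa v, abscissa v ^+ 2).

Definition end1 (E : {set vertex G}) : R :=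
  if enum E is x :: _ then abscissa x else 0.
Definition end2 (E : {set vertex G}) : R :=
  if enum E is [:: _, y & _] then abscissa y else 0.

Definition chord (E : {set vertex G}) (t : R) : R * R :=
  (end1 E + t * (end2 E - end1 E),
   end1 E ^+ 2 + t * (end2 E ^+ 2 - end1 E ^+ 2)).

Lemma endsP (E : {set vertex G}) : E \in edges G ->
  exists x y : vertex G, [/\ x != y, E = [set x; y]%SET,
    end1 E = abscissa x & end2 E = abscissa y].
Proof.
move=> /edgesP[x [y [xy EE]]].
have sE : size (enum E) = 2%N by rewrite -cardE EE cards2 xy.
rewrite /end1 /end2.
have uE := enum_uniq (mem E).
have mE u : (u \in E) = (u \in enum E) by rewrite mem_enum.
case: (enum E) sE uE mE => [//|u [//|v [|//]]] _ uE mE.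
exists u, v; split=> //; first by move: uE; rewrite /= inE andbT.
by apply/setP => w; rewrite mE !inE.
Qed.

Lemma chord_line E t : (chord E t).2 =
  (end1 E + end2 E) * (chord E t).1 - end1 E * end2 E.
Proof. by rewrite /chord /=; ring. Qed.

Lemma chord_continuous E : continuous (chord E).
Proof.
have line (a b : R) : continuous (fun t : R => a + t * b).
  move=> t; apply: (@cvgD _ R^o); first exact: cvg_cst.
  by apply: cvgM; [exact: cvg_id|exact: cvg_cst].
move=> t; rewrite /continuous_at /chord.
exact: (cvg_pair (@line _ _ t) (@line _ _ t)).
Qed.

Lemma parabola_inj : injective parabola.
Proof. by move=> u v [/abscissa_inj]. Qed.

Lemma ends_neq E : E \in edges G -> end2 E - end1 E != 0.
Proof.
move=> /endsP[x [y [xy _ -> ->]]]; rewrite subr_eq0 eq_sym.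
by apply: contra_neq xy => /abscissa_inj.
Qed.

Lemma chord_simple E : E \in edges G -> set_inj `[0, 1] (chord E).
Proof.
move=> /ends_neq eE s t _ _ [/addrI /(mulIf eE) //].
Qed.

Lemma chord_ends E : E \in edges G ->
  chord E @` [set 0; 1] = parabola @` [set` E].
Proof.
move=> /endsP[x [y [xy EE e1 e2]]].
have c0 : chord E 0 = parabola x.
  by rewrite /chord !mul0r !addr0 e1.
have c1 : chord E 1 = parabola y.
  by rewrite /chord !mul1r !subrKC e2.
apply/seteqP; split=> p.
  case=> t [->|->] <-; [rewrite c0|rewrite c1].
    by exists x => //=; rewrite EE !inE eqxx.
  by exists y => //=; rewrite EE !inE eqxx orbT.
case=> v /=; rewrite EE !inE => /orP[] /eqP -> <-.
  by exists 0; [left|rewrite -EE c0].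
by exists 1; [right|rewrite -EE c1].
Qed.

Lemma chord_avoids E : E \in edges G ->
  forall t v, t \in `]0, 1[ -> chord E t <> parabola v.
Proof.
move=> EG t v /=; rewrite in_itv /= => /andP[t0 t1] ev.
have e12 := ends_neq EG.
have := chord_line E t; rewrite ev /=.
move/eqP; rewrite -subr_eq0.
have -> : abscissa v ^+ 2 - ((end1 E + end2 E) * abscissa v - end1 E * end2 E)
  = (abscissa v - end1 E) * (abscissa v - end2 E) by ring.
have -> : abscissa v = end1 E + t * (end2 E - end1 E) by case: ev.
have -> : (end1 E + t * (end2 E - end1 E) - end1 E) *
  (end1 E + t * (end2 E - end1 E) - end2 E) =
  (t * (t - 1)) * ((end2 E - end1 E) * (end2 E - end1 E)) by ring.
by rewrite !mulf_eq0 (negbTE e12) subr_eq0 (gt_eqF t0) (lt_eqF t1).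
Qed.

Definition parabola_drawing : drawing R G :=
  @Drawing R G parabola chord parabola_inj
    (fun E _ => continuous_subspaceT (@chord_continuous E))
    chord_simple chord_ends chord_avoids.

Lemma chord_inter E F p q : E \in edges G -> F \in edges G -> E != F ->
  (range (chord E) `&` range (chord F)) p ->
  (range (chord E) `&` range (chord F)) q -> p = q.
Proof.
move=> EG FG EF [[s _ Es] [s' _ Fs]] [[t _ Et] [t' _ Ft]].
have [lE lF mE mF] : [/\ p.2 = (end1 E + end2 E) * p.1 - end1 E * end2 E,
  p.2 = (end1 F + end2 F) * p.1 - end1 F * end2 F,
  q.2 = (end1 E + end2 E) * q.1 - end1 E * end2 E &
  q.2 = (end1 F + end2 F) * q.1 - end1 F * end2 F].
  split; [rewrite -Es|rewrite -Fs|rewrite -Et|rewrite -Ft];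
    exact: chord_line.
have [pq|pq] := eqVneq p.1 q.1.
  by rewrite (surjective_pairing p) (surjective_pairing q) lE mE pq.
have sEF : end1 E + end2 E = end1 F + end2 F.
  have : (end1 E + end2 E - (end1 F + end2 F)) * (p.1 - q.1) = 0.
    by transitivity ((p.2 - q.2) - (p.2 - q.2));
       [rewrite {1}lE {1}mE lF mF; ring|exact: subrr].
  by move/eqP; rewrite mulf_eq0 !subr_eq0 (negbTE pq) orbF => /eqP.
have pEF : end1 E * end2 E = end1 F * end2 F.
  by move: lF; rewrite lE sEF => /addrI /oppr_inj.
have root a : a ^+ 2 - (end1 E + end2 E) * a + end1 E * end2 E =
    (a - end1 E) * (a - end2 E) by ring.
have root' a : a ^+ 2 - (end1 E + end2 E) * a + end1 E * end2 E =
    (a - end1 F) * (a - end2 F) by rewrite sEF pEF; ring.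
case/endsP: (EG) => x [y [_ EE x1 y1]].
case/endsP: (FG) => u [v [_ FF u1 v1]].
case/negP: EF; apply/eqP/setP => w.
have memE : (w \in E) = ((abscissa w - end1 E) * (abscissa w - end2 E) == 0).
  by rewrite mulf_eq0 !subr_eq0 x1 y1 !(inj_eq abscissa_inj) EE !inE.
have memF : (w \in F) = ((abscissa w - end1 F) * (abscissa w - end2 F) == 0).
  by rewrite mulf_eq0 !subr_eq0 u1 v1 !(inj_eq abscissa_inj) FF !inE.
by rewrite memE memF -root root'.
Qed.

Lemma drawable_ex : exists k, `[< drawable_with R G k >].
Proof.
suff /finite_setP[k Dk] : finite_set (crossings parabola_drawing).
  by exists k; apply/asboolP; exists parabola_drawing.
pose I (EF : {set vertex G} * {set vertex G}) :
    set ({set {set vertex G}} * (R * R)) :=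
  [set c | [/\ EF.1 \in edges G, EF.2 \in edges G, EF.1 != EF.2,
    c.1 = [set EF.1; EF.2]%SET &
    (range (chord EF.1) `&` range (chord EF.2)) c.2]].
apply: (@sub_finite_set _ _ (\bigcup_(EF in setT) I EF)).
  move=> c [E [F [EG FG EF cEF [[s _ sc] [t _ tc]]]]].
  exists (E, F) => //; split=> //=.
  by split; [exists s|exists t].
apply: bigcup_finite => // EF _.
have [->|/set0P[c Ic]] := eqVneq (I EF) set0; first exact: finite_set0.
apply: (@sub_finite_set _ _ [set c]) => // d [EG FG nEF d1 d2].
have [_ _ _ c1 c2] := Ic.
rewrite /= (surjective_pairing d) (surjective_pairing c) d1 c1.
by rewrite (chord_inter EG FG nEF d2 c2).
Qed.

End DrawingExists.

(* Drawings with infinitely many crossings do not take part in the minimum. *)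
Definition crossing_number (R : realType) (G : sgraph) : nat :=
  ex_minn (drawable_ex R G).

(* [inl i] is a_i and [inr j] is b_j. *)
Definition Knn_minus_nK2_adj (n : nat) : rel ('I_n + 'I_n) :=
  fun u v => match u, v with
    | inl i, inr j => i != j
    | inr j, inl i => i != j
    | _, _ => false
    end.

Lemma Knn_minus_nK2_adj_sym n : symmetric (@Knn_minus_nK2_adj n).
Proof. by case=> i [] j. Qed.

Lemma Knn_minus_nK2_adj_irr n : irreflexive (@Knn_minus_nK2_adj n).
Proof. by case. Qed.

Definition Knn_minus_nK2 (n : nat) : sgraph :=
  SGraph (@Knn_minus_nK2_adj_sym n) (@Knn_minus_nK2_adj_irr n).

(* Main.v *)
Require Import Defs.
From mathcomp Require Import all_boot all_order all_algebra.
From mathcomp Require Import all_classical all_reals all_analysis.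
From mathcomp Require Import ring lra zify.

(* Put a_i on the sphere in the direction (-1)^i (1, i, i^2) of the moment
   curve, put b_i at the antipode of a_i, draw every edge as the shorter
   great-circle arc, and project stereographically from (0, 0, 1), which lies on
   no arc. Two arcs meet only if their four end vectors admit a linear
   dependency of the right signs. Three points of the moment curve are
   independent, so the four indices are distinct; the dependency between four
   points p < q < r < s of the curve has alternating signs, so every crossing
   forces a condition on the parities of p, q, r, s. The parity patterns that
   occur are xxxx, xxyy and xyyx, each quadruple with such a pattern carries
   exactly 4 crossings, and counting these quadruples gives the bound. *)

Set Implicit Arguments.
Unset Strict Implicit.
Unset Printing Implicit Defensive.

Import Order.TTheory GRing.Theory Num.Theory.
Import numFieldNormedType.Exports.

(** * Counting decreasing chains with prescribed parities *)

(* Decreasing sequences of naturals below [n], largest element first, with the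
   parities (true = odd) listed by [pat]. *)
Fixpoint parity_chains (pat : seq bool) (n : nat) {struct n} : seq (seq nat) :=
  match pat, n with
  | [::], _ => [:: [::]]
  | _ :: _, 0 => [::]
  | c :: pat', m.+1 => parity_chains pat m ++
      (if c == odd m then [seq m :: t | t <- parity_chains pat' m] else [::])
  end.

Lemma mem_parity_chains n t :
  path gtn n t -> t \in parity_chains (map odd t) n.
Proof.
elim: n t => [|n IH] [|a t] //= /andP[an at_].
rewrite mem_cat; move: an; rewrite /= ltnS leq_eqVlt => /orP[/eqP ean|an].
  apply/orP; right; subst a; rewrite eqxx; apply: map_f; exact: IH.
by rewrite IH //= an.
Qed.

(* Halving the entries turns a chain with parities [pat] into a sequence that
   decreases strictly, except weakly at the places counted here: an even entry
   right after an odd one (or under an odd bound). *)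
Fixpoint rises (b : bool) (pat : seq bool) : nat :=
  if pat is c :: pat' then (b && ~~ c) + rises c pat' else 0.

Lemma rises_le b pat : rises b pat <= size pat.
Proof.
by elim: pat b => //= c pat IH b; have := IH c; case: (b && ~~ c); lia.
Qed.

(** Induction on [n]: if the leading parity [c] is that of [n], the two summands are the terms of
    Pascal's rule; otherwise the upper argument of the binomial does not change. *)
Lemma size_parity_chains pat n :
  size (parity_chains pat n) = 'C(n./2 + rises (odd n) pat, size pat).
Proof.
elim: n pat => [|n IH] [|c pat] //=; rewrite ?bin0 //.
  by rewrite bin_small // add0n ltnS rises_le.
rewrite size_cat IH /= uphalf_half.
have -> : size (if c == odd n then [seq n :: t | t <- parity_chains pat n]
                else [::])
    = if c == odd n then size (parity_chains pat n) else 0.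
  by case: ifP => //; rewrite size_map.
rewrite IH; case: (odd n) c => [] [] /=;
  by rewrite ?add0n ?addn0 ?add1n ?addSn ?addnS.
Qed.

(** A form free of division, in which [lia] can compare binomials with products of halves. *)
Lemma bin4_mul24 a : 'C(a.+4, 4) * 24 = a.+4 * a.+3 * a.+2 * a.+1.
Proof. by rewrite -[24]/(4`!) bin_ffact !ffactnS ffactn0 /=; lia. Qed.

(* For an edge joining indices p < q and one joining z < w, with p < z: the
   parities allowing a crossing when q < z < w, z < q < w and z < w < q
   respectively. *)
Definition adjacent_patterns :=
  [:: [:: true; true; true; true]; [:: false; false; false; false];
      [:: true; true; false; false]; [:: false; false; true; true]].
Definition interleaved_patterns :=
  [:: [:: true; false; false; true]; [:: false; true; true; false];
      [:: true; true; false; false]; [:: false; false; true; true]].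
Definition nested_patterns :=
  [:: [:: true; true; true; true]; [:: false; false; false; false];
      [:: true; false; false; true]; [:: false; true; true; false]].

Definition parity_quads pats n :=
  flatten [seq parity_chains pat n | pat <- pats].

Lemma size_parity_quads n :
  2 * (size (parity_quads adjacent_patterns n)
       + size (parity_quads interleaved_patterns n)
       + size (parity_quads nested_patterns n)) =
  n %/ 2 * ((n - 1) %/ 2) * ((n - 2) %/ 2) * ((n - 3) %/ 2).
Proof.
rewrite /parity_quads /= !size_cat !size_parity_chains /= !addn0 !add0n.
set m := n./2.
have en : n = odd n + m.*2 by rewrite odd_double_half.
have -> : n %/ 2 = m by rewrite divn2.
have -> : (n - 1) %/ 2 = odd n + m - 1 by rewrite en; case: (odd n); lia.
have -> : (n - 2) %/ 2 = m - 1 by rewrite en; case: (odd n); lia.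
have -> : (n - 3) %/ 2 = odd n + m - 2 by rewrite en; case: (odd n); lia.
clearbody m; case: (odd n) {en} => /=;
  rewrite ?addn0 ?addn1 ?addn2 ?add0n.
  (* Odd [n]: the identity is 4 C(m,4) + 16 C(m+1,4) + 4 C(m+2,4) = m^2 (m-1)^2. *)
  case: m => [|[|[|[|m]]]] //; rewrite ?addn0 ?addn1 ?addn2 ?addn3.
  have b0 := bin4_mul24 m; have b1 := bin4_mul24 m.+1.
  have b2 := bin4_mul24 m.+2.
  by clear n; lia.
(* Even [n]: the identity is 12 C(m,4) + 12 C(m+1,4) = m (m-1)^2 (m-2). *)
case: m => [|[|[|[|m]]]] //.
by have b0 := bin4_mul24 m; have b1 := bin4_mul24 m.+1; lia.
Qed.

Local Open Scope classical_set_scope.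
Local Open Scope card_scope.
Local Open Scope ring_scope.

(** * Stereographic projection from the pole *)

Section Stereographic.
Variable R : realType.
Implicit Types v w : nat -> R.

(* A vector of R^3 is a function on nat of which only the values at 0, 1 and 2
   matter. *)
Definition depth v : R := Num.sqrt (v 0 ^+ 2 + v 1 ^+ 2 + v 2 ^+ 2) - v 2.
(** Invariant under positive scaling of [v], so a chord needs no normalisation: its image is that of
    the great-circle arc above it. *)
Definition stereo v : R * R := (v 0 / depth v, v 1 / depth v).

Definition off_axis v := (v 0 != 0) || (v 1 != 0).

Lemma depth_gt0 v : off_axis v -> 0 < depth v.
Proof.
move=> v01; rewrite subr_gt0; apply: le_lt_trans (ler_norm _) _.
rewrite -sqrtr_sqr ltr_sqrt.
  rewrite ltrDr; case/orP: v01 => v0.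
    by rewrite ltr_wpDr ?sqr_ge0 // exprn_even_gt0.
  by rewrite ltr_wpDl ?sqr_ge0 // exprn_even_gt0.
case/orP: v01 => v0.
  by rewrite -addrA ltr_wpDr ?addr_ge0 ?sqr_ge0 // exprn_even_gt0.
by rewrite ltr_wpDr ?sqr_ge0 // ltr_wpDl ?sqr_ge0 // exprn_even_gt0.
Qed.

Lemma depth_sqr v : v 0 ^+ 2 + v 1 ^+ 2 = depth v * (depth v + v 2 *+ 2).
Proof.
rewrite /depth; set s := Num.sqrt _.
have es : s ^+ 2 = v 0 ^+ 2 + v 1 ^+ 2 + v 2 ^+ 2.
  by rewrite sqr_sqrtr // !addr_ge0 // sqr_ge0.
have -> : (s - v 2) * (s - v 2 + v 2 *+ 2) = s ^+ 2 - v 2 ^+ 2 by ring.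
by rewrite es; ring.
Qed.

(** [depth] is homogeneous of degree 1, so the factor must be the ratio of the depths. The third
    coordinate then follows from [depth_sqr], which is linear in [v 2] once the depth is fixed. *)
Lemma stereo_inj v w : off_axis v -> off_axis w -> stereo v = stereo w ->
  exists2 c : R, 0 < c & forall k, (k < 3)%N -> v k = c * w k.
Proof.
move=> /depth_gt0 rv /depth_gt0 rw [e0 e1].
have ev := depth_sqr v; have ew := depth_sqr w.
have nv : depth v != 0 by rewrite gt_eqF.
have nw : depth w != 0 by rewrite gt_eqF.
set c := depth v / depth w.
have c0 : 0 < c by rewrite divr_gt0.
have ec : depth v = c * depth w by rewrite divfK.
have e0' : v 0 = c * w 0 by rewrite -[v 0](divfK nv) e0 /c; field.
have e1' : v 1 = c * w 1 by rewrite -[v 1](divfK nv) e1 /c; field.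
clearbody c; exists c => // -[|[|[|//]]] _ //.
have : (c * depth w * 2) * (v 2 - c * w 2) = 0.
  have : c ^+ 2 * (w 0 ^+ 2 + w 1 ^+ 2) = v 0 ^+ 2 + v 1 ^+ 2.
    by rewrite e0' e1'; ring.
  rewrite ev ew ec => /eqP; rewrite -subr_eq0 => /eqP h.
  by rewrite -[RHS]oppr0 -[in RHS]h; ring.
move/eqP; rewrite mulf_eq0 subr_eq0 => /orP[|/eqP //].
by rewrite !mulf_eq0 (gt_eqF c0) (gt_eqF rw) pnatr_eq0.
Qed.

Lemma stereo_continuous (v : R -> nat -> R) :
  (forall k, continuous (fun t => v t k)) -> (forall t, off_axis (v t)) ->
  continuous (fun t => stereo (v t)).
Proof.
move=> cv av t.
have cd : {for t, continuous (fun t => depth (v t))}.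
  apply: (@cvgB _ R^o); last exact: cv.
  apply: (@continuous_comp _ _ _ (fun t => v t 0 ^+ 2 + v t 1 ^+ 2 + v t 2 ^+ 2)
    (@Num.sqrt R)); last exact: sqrt_continuous.
  by apply: (@cvgD _ R^o); [apply: (@cvgD _ R^o)|]; apply: cvgM; exact: cv.
have ci : {for t, continuous (fun t => (depth (v t))^-1)}.
  by apply: continuousV => //; rewrite gt_eqF // depth_gt0.
rewrite /continuous_at /stereo.
exact: (cvg_pair (cvgM (cv 0%N t) ci) (cvgM (cv 1%N t) ci)).
Qed.

End Stereographic.

(** * Linear dependencies between points of the moment curve *)

Section Moments.
Variable R : realType.

Lemma moment2_eq0 (A B a b : R) : a != b ->
  A + B = 0 -> A * a + B * b = 0 -> A = 0.
Proof.
move=> ab e0 e1; have : A * (a - b) = 0.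
  have -> : A * (a - b) = (A * a + B * b) - b * (A + B) by ring.
  by rewrite e0 e1 mulr0 subrr.
by move/eqP; rewrite mulf_eq0 subr_eq0 (negbTE ab) orbF => /eqP.
Qed.

(** Combining the relations with the coefficients of (x - b)(x - c) isolates the term of [a]. The
    nodes [b] and [c] may coincide. *)
Lemma moment3_eq0 (A B C a b c : R) : a != b -> a != c ->
  (forall k, (k < 3)%N -> A * a ^+ k + B * b ^+ k + C * c ^+ k = 0) -> A = 0.
Proof.
move=> ab ac e; have : A * ((a - b) * (a - c)) = 0.
  have := e 0%N isT; have := e 1%N isT; have := e 2%N isT.
  rewrite !expr0 !mulr1 !expr1.
  move=> e2 e1 e0.
  have -> : A * ((a - b) * (a - c)) =
    (A * a ^+ 2 + B * b ^+ 2 + C * c ^+ 2) - (b + c) * (A * a + B * b + C * c)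
     + b * c * (A + B + C) by ring.
  by rewrite e0 e1 e2; ring.
by move/eqP; rewrite !mulf_eq0 !subr_eq0 (negbTE ab) (negbTE ac) !orbF => /eqP.
Qed.

(** A quadratic vanishing at two of the nodes leaves two terms of the dependency; if it has the same
    sign at both remaining nodes, their coefficients have opposite signs. The root pairs c, d and a,
    b and a, d give the three comparisons. *)
Lemma moment4_signs (b1 b2 b3 b4 : bool) (A B C D a b c d : R) :
  0 < A -> 0 < B -> 0 < C -> 0 < D -> a < b -> b < c -> c < d ->
  (forall k, (k < 3)%N -> (-1) ^+ b1 * A * a ^+ k + (-1) ^+ b2 * B * b ^+ k
     + (-1) ^+ b3 * C * c ^+ k + (-1) ^+ b4 * D * d ^+ k = 0) ->
  [/\ b2 = ~~ b1, b3 = b1 & b4 = ~~ b1].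
Proof.
move=> A0 B0 C0 D0 ab bc cd e.
have := e 0%N isT; have := e 1%N isT; have := e 2%N isT.
rewrite !expr0 !mulr1 !expr1.
move=> e2 e1 e0.
have opp (s1 s2 : bool) (X Y : R) : 0 < X -> 0 < Y ->
    (-1) ^+ s1 * X + (-1) ^+ s2 * Y = 0 -> s2 = ~~ s1.
  by case: s1 s2 => [] [] // X0 Y0; rewrite ?expr0 ?expr1; lra.
have test x y : (-1) ^+ b1 * (A * ((a - x) * (a - y)))
    + (-1) ^+ b2 * (B * ((b - x) * (b - y)))
    + (-1) ^+ b3 * (C * ((c - x) * (c - y)))
    + (-1) ^+ b4 * (D * ((d - x) * (d - y))) = 0.
  have := congr2 (fun u v => u - v) e2 (congr1 (fun u => (x + y) * u) e1).
  move=> /(congr1 (fun u => u + x * y * ((-1) ^+ b1 * A + (-1) ^+ b2 * B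
     + (-1) ^+ b3 * C + (-1) ^+ b4 * D))).
  rewrite {2}e0 !mulr0 subr0 addr0 => <-; ring.
have pos x y : 0 < x -> 0 < y -> 0 < x * y by exact: mulr_gt0.
have h12 : b2 = ~~ b1.
  apply: (opp b1 b2 (A * ((a - c) * (a - d))) (B * ((b - c) * (b - d)))).
  - by rewrite pos // nmulr_rgt0 subr_lt0 ?(lt_trans ab) // (lt_trans bc).
  - by rewrite pos // nmulr_rgt0 subr_lt0 // (lt_trans bc).
  by have := test c d; rewrite !subrr !(mul0r, mulr0, addr0).
have h34 : b4 = ~~ b3.
  apply: (opp b3 b4 (C * ((c - a) * (c - b))) (D * ((d - a) * (d - b)))).
  - by rewrite pos // pos // subr_gt0 // (lt_trans ab).
  - rewrite pos // pos // subr_gt0 ?(lt_trans bc) //.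
    by rewrite (lt_trans ab) // (lt_trans bc).
  by have := test a b; rewrite !subrr !(mul0r, mulr0, addr0, add0r).
have h23 : b3 = ~~ b2.
  (* The quadratic is negative between its roots [a] and [d]; reversing one factor makes both
     weights positive. *)
  apply: (opp b2 b3 (B * ((b - a) * (d - b))) (C * ((c - a) * (d - c)))).
  - by rewrite pos // pos // subr_gt0 // (lt_trans bc).
  - by rewrite pos // pos // subr_gt0 // (lt_trans ab).
  have := test a d; rewrite !subrr !(mul0r, mulr0, addr0, add0r) => h.
  by apply: oppr_inj; rewrite oppr0 -[RHS]h; ring.
by rewrite h34 h23 h12 negbK.
Qed.

End Moments.

(** The position of [f x] in [L] injects [A] into an initial segment of the naturals; this yields
    the exact cardinal that [drawable_with] asks for. *)
Lemma card_eq_II_seq (T : Type) (U : eqType) (A : set T) (f : T -> U)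
    (L : seq U) :
  set_inj A f -> (forall x, A x -> f x \in L) ->
  exists2 k : nat, (k <= size L)%N & A #= `I_k.
Proof.
move=> fI fL; pose g x := index (f x) L.
have gI : set_inj A g.
  move=> x y; rewrite !inE => Ax Ay gxy; apply: fI; rewrite ?inE //.
  by rewrite -(nth_index (f x) (fL x Ax)) -/(g x) gxy nth_index // fL.
have gA : A #= g @` A by rewrite card_eq_sym; exact: inj_card_eq.
have leA : (A #<= `I_(size L)).
  rewrite (card_le_eql gA); apply: subset_card_le => _ [x Ax <-].
  by rewrite /= index_mem fL.
have /finite_setP[k Ak] : finite_set A.
  by apply: card_le_finite leA _; exact: finite_II.
by exists k => //; rewrite -card_le_II -(card_le_eql Ak).
Qed.

(** * The antipodal drawing and its validity *)

Section Drawing.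
Variables (R : realType) (n : nat).
Local Notation G := (Knn_minus_nK2 n).
Local Notation V := ('I_n + 'I_n)%type.

Definition index_of (u : V) : nat := match u with inl i => i | inr j => j end.
Definition on_b_side (u : V) : bool := if u is inr _ then true else false.

Definition vec_sign (u : V) : R := (-1) ^+ (on_b_side u + index_of u)%N.

Definition antipodal_vec (u : V) (k : nat) : R :=
  vec_sign u * (index_of u)%:R ^+ k.

Definition weight (u : V) (t : R) : R := if on_b_side u then t else 1 - t.

(* The chord of [E], run from its a-end to its b-end; the sum avoids having to
   choose the ends of [E]. *)
Definition segment (E : {set V}) (t : R) (k : nat) : R :=
  \sum_(u in E) weight u t * antipodal_vec u k.

Lemma segmentE (i j : 'I_n) t k : segment [set inl i; inr j]%SET t k =
  (1 - t) * antipodal_vec (inl i) k + t * antipodal_vec (inr j) k.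
Proof. by rewrite /segment big_setU1 ?inE // big_set1. Qed.

Lemma Knn_edgesP (E : {set V}) : E \in edges G ->
  exists i j : 'I_n, i != j /\ E = [set inl i; inr j]%SET.
Proof.
rewrite inE => /existsP[[x|x] /existsP[[y|y] //= /andP[xy /eqP ->]]].
  by exists x, y.
by exists y, x; rewrite finset.setUC.
Qed.

Lemma vec_sign_neq0 u : vec_sign u != 0.
Proof. by rewrite expf_neq0 // oppr_eq0 oner_eq0. Qed.

Lemma natr_neq (a b : nat) : a != b -> a%:R != b%:R :> R.
Proof. by rewrite eqr_nat. Qed.

Lemma vec_off_axis u : off_axis (antipodal_vec u).
Proof. by rewrite /off_axis /antipodal_vec expr0 mulr1 vec_sign_neq0. Qed.

Lemma segment_inj i j (s t c : R) : i != j ->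
  (forall k, (k < 3)%N -> segment [set inl i; inr j]%SET t k
     = c * segment [set inl i; inr j]%SET s k) ->
  1 - t = c * (1 - s) /\ t = c * s.
Proof.
move=> ij e; have := e 1%N isT; have := e 0%N isT; rewrite !segmentE.
rewrite /antipodal_vec /= !expr0 !mulr1 !expr1 => e0 e1.
have := vec_sign_neq0 (inl i); have := vec_sign_neq0 (inr j).
move: (vec_sign _) (vec_sign _) e0 e1 => b a e0 e1 b0 a0.
have h0 : (1 - t - c * (1 - s)) * a + (t - c * s) * b = 0 by move: e0; lra.
have h1 : (1 - t - c * (1 - s)) * a * i%:R + (t - c * s) * b * j%:R = 0.
  by move: e1; lra.
have hA := moment2_eq0 (natr_neq ij) h0 h1.
move: h0; rewrite hA add0r => hB.
move: hA hB => /eqP + /eqP; rewrite !mulf_eq0 (negbTE a0) (negbTE b0) !orbF.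
by rewrite !subr_eq0 => /eqP -> /eqP ->.
Qed.

(** Since [i != j], the end vectors are independent already in coordinates 0 and 1, so both weights
    [1 - t] and [t] would vanish. An edge between the antipodes a_i and b_i would break this. *)
Lemma segment_off_axis E t : E \in edges G -> off_axis (segment E t).
Proof.
move=> /Knn_edgesP[i [j [ij ->]]]; rewrite /off_axis -negb_and; apply/negP.
move=> /andP[/eqP e0 /eqP e1].
suff : 1 = 0 :> R by apply/eqP; rewrite oner_eq0.
move: e0 e1; rewrite !segmentE /antipodal_vec /=.
rewrite !expr0 !mulr1 !expr1 !mulrA => e0 e1.
have := vec_sign_neq0 (inl i); have := vec_sign_neq0 (inr j).
move: (vec_sign _) (vec_sign _) e0 e1 => b a e0 e1 b0 a0.
have hA := moment2_eq0 (natr_neq ij) e0 e1.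
move: e0; rewrite hA add0r => /eqP; move/eqP: hA.
rewrite !mulf_eq0 (negbTE a0) (negbTE b0) !orbF subr_eq0 => /eqP <-.
by move=> /eqP.
Qed.

Definition draw_point (u : V) : R * R := stereo (antipodal_vec u).
Definition draw_arc (E : {set V}) (t : R) : R * R := stereo (segment E t).

Lemma draw_point_inj : injective draw_point.
Proof.
move=> u v /(stereo_inj (vec_off_axis u) (vec_off_axis v))[c c0 e].
have [iuv|/natr_neq iuv] := eqVneq (index_of u) (index_of v); last first.
  have := e 1%N isT; have := e 0%N isT.
  rewrite /antipodal_vec !expr0 !mulr1 !expr1.
  move=> /eqP; rewrite -subr_eq0 => /eqP e0 /eqP.
  rewrite mulrA -subr_eq0 -mulNr => /eqP e1.
  by have := moment2_eq0 iuv e0 e1 => /eqP; rewrite (negbTE (vec_sign_neq0 _)).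
have s0 : (-1) ^+ index_of v != 0 :> R.
  by rewrite expf_neq0 // oppr_eq0 oner_eq0.
have := e 0%N isT.
rewrite /antipodal_vec /vec_sign !expr0 !mulr1 iuv !exprD mulrA.
move=> /(mulIf s0) {s0}.
by case: u v iuv {e} => i [] j /= /val_inj -> //; rewrite ?expr0 ?expr1 => h;
  exfalso; lra.
Qed.

Lemma draw_arc_continuous E :
  E \in edges G -> {within `[0, 1], continuous (draw_arc E)}.
Proof.
move=> EG; apply: continuous_subspaceT; apply: stereo_continuous.
  move=> k t; have /Knn_edgesP[i [j [_ ->]]] := EG.
  rewrite /continuous_at.
  under eq_fun do rewrite segmentE.
  rewrite segmentE.
  apply: (@cvgD _ R^o); apply: cvgM; try exact: cvg_cst; last exact: cvg_id.
  by apply: (@cvgB _ R^o); [exact: cvg_cst|exact: cvg_id].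
by move=> t; exact: segment_off_axis.
Qed.

Lemma draw_arc_simple E : E \in edges G -> set_inj `[0, 1] (draw_arc E).
Proof.
move=> EG s t _ _.
move=> /(stereo_inj (segment_off_axis s EG) (segment_off_axis t EG))[c _].
have /Knn_edgesP[i [j [ij ->]]] := EG => /(segment_inj ij)[e1 e2].
have c1 : c = 1 by move: e1 e2; lra.
by rewrite e2 c1 mul1r.
Qed.

Lemma draw_arc_ends E : E \in edges G ->
  draw_arc E @` [set 0; 1] = draw_point @` [set` E].
Proof.
move=> /Knn_edgesP[i [j [_ EE]]].
have c0 : draw_arc E 0 = draw_point (inl i).
  rewrite /draw_arc /draw_point EE; congr stereo; apply/funext => k.
  by rewrite segmentE subr0 mul1r mul0r addr0.
have c1 : draw_arc E 1 = draw_point (inr j).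
  rewrite /draw_arc /draw_point EE; congr stereo; apply/funext => k.
  by rewrite segmentE subrr mul0r mul1r add0r.
apply/seteqP; split=> p.
  case=> t [->|->] <-; [rewrite c0|rewrite c1].
    by exists (inl i) => //=; rewrite EE !inE eqxx.
  by exists (inr j) => //=; rewrite EE !inE eqxx orbT.
case=> v /=; rewrite EE !inE => /orP[] /eqP -> <-.
  by exists 0; [left|rewrite -EE c0].
by exists 1; [right|rewrite -EE c1].
Qed.

Lemma draw_arc_avoids E : E \in edges G ->
  forall t v, t \in `]0, 1[ -> draw_arc E t <> draw_point v.
Proof.
move=> EG t v; rewrite in_itv /= => /andP[t0 t1].
move=> /(stereo_inj (segment_off_axis t EG) (vec_off_axis v))[c c0].
have /Knn_edgesP[i [j [ij ->]]] := EG => e.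
have {}e k : (k < 3)%N -> (1 - t) * vec_sign (inl i) * i%:R ^+ k
    + t * vec_sign (inr j) * j%:R ^+ k
    + (- c * vec_sign v) * (index_of v)%:R ^+ k = 0.
  by move=> /e; rewrite segmentE /antipodal_vec /= !mulrA => ->; ring.
(* If [v] has index [j], the coefficient at [i] can be isolated; otherwise the one at [j] can, even
   if [v] has index [i]. *)
have [vi|vi] := eqVneq (index_of v) j.
  have : (1 - t) * vec_sign (inl i) = 0.
    by apply: (moment3_eq0 (natr_neq ij) _ e); rewrite vi natr_neq.
  by apply/eqP; rewrite mulf_neq0 ?vec_sign_neq0 // subr_eq0 gt_eqF.
have ji : (j : nat) != i by rewrite eq_sym.
have jv : (j : nat) != index_of v by rewrite eq_sym.
have : t * vec_sign (inr j) = 0.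
  apply: (@moment3_eq0 _ _ ((1 - t) * vec_sign (inl i)) (- c * vec_sign v) _ _ _
    (natr_neq ji) (natr_neq jv)) => k /e h.
  by rewrite -[RHS]h [X in X + _ = _]addrC.
by apply/eqP; rewrite mulf_neq0 ?vec_sign_neq0 // gt_eqF.
Qed.

Definition antipodal_drawing : drawing R G :=
  @Drawing R G draw_point draw_arc draw_point_inj draw_arc_continuous
    draw_arc_simple draw_arc_ends draw_arc_avoids.

End Drawing.

(** * Pairs of arcs that cross *)

Section Crossings.
Variables (R : realType) (n : nat).
Local Notation G := (Knn_minus_nK2 n).
Local Notation V := ('I_n + 'I_n)%type.

(* The edge joining indices [p] and [q], with [p] on the b-side iff [d]. *)
Definition edge_of (d : bool) (p q : nat) : {set V} :=
  [set u : V | match u with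
           | inl i => (i : nat) == (if d then q else p)
           | inr j => (j : nat) == (if d then p else q)
           end]%SET.

(* The point of the chord of [edge_of d p q] with weight [a] at index [p]. *)
Definition oriented (d : bool) (p q : nat) (a : R) (k : nat) : R :=
  (-1) ^+ (d (+) odd p) * a * p%:R ^+ k
  + (-1) ^+ (~~ d (+) odd q) * (1 - a) * q%:R ^+ k.

(** Sign alternation concerns ordered nodes, so chords are rewritten to start at the smaller index;
    the weight there is [1 - t] on the a-side and [t] on the b-side. *)
Lemma edge_orientation (E : {set V}) : E \in edges G ->
  exists d p q, [/\ (p < q)%N, (q < n)%N, E = edge_of d p q &
    forall t : R, t \in `]0, 1[ -> exists2 a : R, 0 < a < 1 &
      segment E t = oriented d p q a].
Proof.
move=> /Knn_edgesP[i [j [ij ->]]].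
have sgn (b : bool) (m : nat) : (-1) ^+ (b + m)%N = (-1) ^+ (b (+) odd m) :> R.
  by rewrite -signr_odd oddD oddb.
have /orP[lij|lji] : (i < j)%N || (j < i)%N by rewrite -neq_ltn.
  exists false, i, j; split => //.
    by apply/setP => -[] k; rewrite !inE ?orbF.
  move=> t; rewrite in_itv /= => /andP[t0 t1]; exists (1 - t); first lra.
  apply/funext => k; rewrite segmentE /antipodal_vec /vec_sign !sgn.
  by rewrite /oriented /=; ring.
exists true, j, i; split => //.
  by apply/setP => -[] k; rewrite !inE ?orbF.
move=> t; rewrite in_itv /= => /andP[t0 t1]; exists t; first lra.
apply/funext => k; rewrite segmentE /antipodal_vec /vec_sign !sgn /oriented /=.
by ring.
Qed.

(** A shared index would leave a dependency on at most three nodes with a nonzero coefficient at [p]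
    or [q]. *)
Lemma crossing_disjoint d p q d' z w (a b c : R) :
  (p < q)%N -> (z < w)%N -> (d, p, q) != (d', z, w) ->
  0 < a < 1 -> 0 < b < 1 -> 0 < c ->
  (forall k, (k < 3)%N -> oriented d p q a k = c * oriented d' z w b k) ->
  [/\ p != z, p != w, q != z & q != w].
Proof.
move=> pq zw ne /andP[a0 a1] /andP[b0 b1] c0 e.
pose A : R := (-1) ^+ (d (+) odd p) * a.
pose B : R := (-1) ^+ (~~ d (+) odd q) * (1 - a).
pose C : R := (-1) ^+ (d' (+) odd z) * (c * b).
pose D : R := (-1) ^+ (~~ d' (+) odd w) * (c * (1 - b)).
have A0 : A != 0 by rewrite mulf_neq0 ?signr_eq0 // gt_eqF.
have B0 : B != 0 by rewrite mulf_neq0 ?signr_eq0 // gt_eqF // subr_gt0.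
have {}e k : (k < 3)%N -> A * p%:R ^+ k + B * q%:R ^+ k - C * z%:R ^+ k
    - D * w%:R ^+ k = 0.
  by move=> /e h; rewrite /A /B -/(oriented d p q a k) h /oriented /C /D; ring.
have npq : p != q by rewrite ltn_eqF.
have nqp : q != p by rewrite gtn_eqF.
have indep (X Y Z : R) (x y v : nat) : X != 0 -> x != y -> x != v ->
    (forall k, (k < 3)%N -> X * x%:R ^+ k + Y * y%:R ^+ k + Z * v%:R ^+ k = 0) ->
    False.
  move=> X0 xy xv h; case/eqP: X0.
  exact: moment3_eq0 (natr_neq R xy) (natr_neq R xv) h.
have pz : p != z.
  apply/negP => /eqP pz; have [qw|qw] := eqVneq q w; last first.
    apply: (indep B (A - C) (- D) q p w) => // k /e h.
    by rewrite -[RHS]h pz; ring.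
  (* The edges are a_p b_q and b_p a_q; their vectors at [p] are opposite, so the contributions to
     [A - C] add up and cannot cancel. *)
  have oo : d' = ~~ d by case: (d) (d') ne => [] []; rewrite ?pz ?qw ?eqxx.
  apply: (indep (A - C) (B - D) 0 p q q) => //; last first.
    by move=> k /e h; rewrite -[RHS]h pz qw; ring.
  rewrite /A /C pz oo addNb signrN mulNr opprK -mulrDr mulf_neq0 ?signr_eq0 //.
  by rewrite gt_eqF // addr_gt0 // mulr_gt0.
have qw : q != w.
  apply/negP => /eqP qw; apply: (indep A (B - D) (- C) p q z) => // k /e h.
  by rewrite -[RHS]h qw; ring.
split=> //; apply/negP => /eqP.
  move=> pw; apply: (indep B (A - D) (- C) q p z) => //; first by lia.
  by move=> k /e h; rewrite -[RHS]h pw; ring.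
move=> qz; apply: (indep A (B - C) (- D) p q w) => //; first by lia.
by move=> k /e h; rewrite -[RHS]h qz; ring.
Qed.

(** Taking [1 - a'] times the first relation minus [1 - a] times the second eliminates [q] and
    leaves [a - a'], up to sign, at [p]. *)
Lemma crossing_unique d p q d' z w (a b c a' b' c' : R) :
  p != z -> p != w ->
  (forall k, (k < 3)%N -> oriented d p q a k = c * oriented d' z w b k) ->
  (forall k, (k < 3)%N -> oriented d p q a' k = c' * oriented d' z w b' k) ->
  a = a'.
Proof.
move=> pz pw e e'.
have : (-1) ^+ (d (+) odd p) * (a - a') = 0.
  apply: (@moment3_eq0 _ _
    ((-1) ^+ (d' (+) odd z) * ((1 - a) * c' * b' - (1 - a') * c * b))
    ((-1) ^+ (~~ d' (+) odd w)
       * ((1 - a) * c' * (1 - b') - (1 - a') * c * (1 - b)))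
    _ _ _ (natr_neq R pz) (natr_neq R pw)) => k k3.
  have : (1 - a') * (oriented d p q a k - c * oriented d' z w b k)
    - (1 - a) * (oriented d p q a' k - c' * oriented d' z w b' k) = 0.
    by rewrite e // e' // !subrr !mulr0 subrr.
  by move=> h; rewrite -[RHS]h /oriented; ring.
by move/eqP; rewrite mulf_eq0 signr_eq0 subr_eq0 => /eqP.
Qed.

Lemma moment4_signs_nat (b1 b2 b3 b4 : bool) (A B C D : R) (p q r s : nat) :
  0 < A -> 0 < B -> 0 < C -> 0 < D -> (p < q)%N -> (q < r)%N -> (r < s)%N ->
  (forall k, (k < 3)%N -> (-1) ^+ b1 * A * p%:R ^+ k + (-1) ^+ b2 * B * q%:R ^+ k
     + (-1) ^+ b3 * C * r%:R ^+ k + (-1) ^+ b4 * D * s%:R ^+ k = 0) ->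
  [/\ b2 = ~~ b1, b3 = b1 & b4 = ~~ b1].
Proof.
by move=> A0 B0 C0 D0 pq qr rs; apply: moment4_signs => //; rewrite ltr_nat.
Qed.

(* The side of the second edge is determined by that of the first and by the
   alternation of signs. *)
Definition pair_adjacent (d : bool) (t : seq nat) : {set {set V}} :=
  if t is [:: s; r; q; p] then
    [set edge_of d p q; edge_of (d (+) odd p (+) ~~ odd r) r s]%SET
  else finset.set0.
Definition pair_interleaved (d : bool) (t : seq nat) : {set {set V}} :=
  if t is [:: s; r; q; p] then
    [set edge_of d p r; edge_of (d (+) odd p (+) odd q) q s]%SET
  else finset.set0.
Definition pair_nested (d : bool) (t : seq nat) : {set {set V}} :=
  if t is [:: s; r; q; p] then
    [set edge_of d p s; edge_of (d (+) odd p (+) odd q) q r]%SET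
  else finset.set0.

(** The two values of [d] account for the factor 2 in [size_parity_quads]. *)
Definition crossing_pairs : seq {set {set V}} :=
  [seq pair_adjacent d t |
    d <- [:: true; false], t <- parity_quads adjacent_patterns n] ++
  [seq pair_interleaved d t |
    d <- [:: true; false], t <- parity_quads interleaved_patterns n] ++
  [seq pair_nested d t |
    d <- [:: true; false], t <- parity_quads nested_patterns n].

Lemma size_crossing_pairs : size crossing_pairs =
  (n %/ 2 * ((n - 1) %/ 2) * ((n - 2) %/ 2) * ((n - 3) %/ 2))%N.
Proof.
rewrite -size_parity_quads /crossing_pairs.
move: (parity_quads adjacent_patterns n) (parity_quads interleaved_patterns n)
  (parity_quads nested_patterns n) => ts us vs.
by rewrite /= !cats0 !size_cat !size_map; lia.
Qed.

Lemma mem_parity_quads pats t :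
  path gtn n t -> map odd t \in pats -> t \in parity_quads pats n.
Proof.
move=> nt tp; apply/flatten_mapP; exists (map odd t) => //.
exact: mem_parity_chains.
Qed.

(** The ends of an edge have equal parities exactly when their signs in the dependency differ. By
    alternation, edges with disjoint or nested index intervals join equal parities, and interleaved
    ones join opposite parities. *)
Lemma crossing_pair_mem d p q d' z w (a b c : R) :
  (p < q)%N -> (q < n)%N -> (z < w)%N -> (w < n)%N -> (p < z)%N ->
  q != z -> q != w ->
  0 < a < 1 -> 0 < b < 1 -> 0 < c ->
  (forall k, (k < 3)%N -> oriented d p q a k = c * oriented d' z w b k) ->
  [set edge_of d p q; edge_of d' z w]%SET \in crossing_pairs.
Proof.
move=> pq qn zw wn pz qz qw /andP[a0 a1] /andP[b0 b1] c0 e.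
have a1' : 0 < 1 - a by rewrite subr_gt0.
have cb : 0 < c * b by rewrite mulr_gt0.
have cb' : 0 < c * (1 - b) by rewrite mulr_gt0 // subr_gt0.
have mem_bool (x : bool) : x \in [:: true; false] by case: x.
pose s1 := d (+) odd p; pose s2 := ~~ d (+) odd q.
(* Negated because the second edge moves to the left-hand side. *)
pose s3 := ~~ (d' (+) odd z); pose s4 := ~~ (~~ d' (+) odd w).
have {}e k : (k < 3)%N ->
    (-1) ^+ s1 * a * p%:R ^+ k + (-1) ^+ s2 * (1 - a) * q%:R ^+ k
    + (-1) ^+ s3 * (c * b) * z%:R ^+ k
    + (-1) ^+ s4 * (c * (1 - b)) * w%:R ^+ k = 0.
  move=> /e h; have := subrr (oriented d p q a k); rewrite {2}h => <-.
  by rewrite /oriented /s3 /s4 !signrN; ring.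
rewrite /crossing_pairs mem_cat.
have [qltz|] := ltnP q z.
  have [e2 e3 e4] := moment4_signs_nat a0 a1' cb cb' pq qltz zw e.
  apply/orP; left; apply/allpairsP; exists (d, [:: w; z; q; p]); split => //.
    apply: mem_parity_quads; first by rewrite /= wn zw qltz pq.
    move: e2 e3 e4; rewrite /s1 /s2 /s3 /s4 /=.
    by case: (d) (d') (odd p) (odd q) (odd z) (odd w) => [] [] [] [] [] [].
  congr ([set _; edge_of _ _ _]%SET).
  move: e3; rewrite /s1 /s3 /=.
  by case: (d) (d') (odd p) (odd z) => [] [] [] [].
rewrite leq_eqVlt eq_sym (negbTE qz) orFb => zq.
have [qltw|] := ltnP q w.
  have [e2 e3 e4] : [/\ s3 = ~~ s1, s2 = s1 & s4 = ~~ s1].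
    apply: (moment4_signs_nat a0 cb a1' cb' pz zq qltw) => k /e h.
    by rewrite -[RHS]h; ring.
  apply/orP; right; rewrite mem_cat; apply/orP; left; apply/allpairsP.
  exists (d, [:: w; q; z; p]); split => //.
    apply: mem_parity_quads; first by rewrite /= wn qltw zq pz.
    move: e2 e3 e4; rewrite /s1 /s2 /s3 /s4 /=.
    by case: (d) (d') (odd p) (odd q) (odd z) (odd w) => [] [] [] [] [] [].
  congr ([set _; edge_of _ _ _]%SET).
  move: e2; rewrite /s1 /s3 /=.
  by case: (d) (d') (odd p) (odd z) => [] [] [] [].
rewrite leq_eqVlt eq_sym (negbTE qw) orFb => wq.
have [e2 e3 e4] : [/\ s3 = ~~ s1, s4 = s1 & s2 = ~~ s1].
  apply: (moment4_signs_nat a0 cb cb' a1' pz zw wq) => k /e h.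
  by rewrite -[RHS]h; ring.
apply/orP; right; rewrite mem_cat; apply/orP; right; apply/allpairsP.
exists (d, [:: q; w; z; p]); split => //.
  apply: mem_parity_quads; first by rewrite /= qn wq zw pz.
  move: e2 e3 e4; rewrite /s1 /s2 /s3 /s4 /=.
  by case: (d) (d') (odd p) (odd q) (odd z) (odd w) => [] [] [] [] [] [].
congr ([set _; edge_of _ _ _]%SET).
by move: e2; rewrite /s1 /s3 /=; case: (d) (d') (odd p) (odd z) => [] [] [] [].
Qed.

Lemma meet_pair_mem (E F : {set V}) P :
  E \in edges G -> F \in edges G -> E != F ->
  (@draw_arc R n E @` `]0, 1[ `&` @draw_arc R n F @` `]0, 1[) P ->
  [set E; F]%SET \in crossing_pairs.
Proof.
move=> EG FG EF [[t t01 tP] [s s01 sP]].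
have [c c0] := stereo_inj (segment_off_axis t EG) (segment_off_axis s FG)
  (etrans tP (esym sP)).
have [d [p [q [pq qn EE oE]]]] := edge_orientation EG.
have [a a01 ->] := oE t t01.
have [d' [z [w [zw wn FF oF]]]] := edge_orientation FG.
have [b b01 ->] := oF s s01.
move=> e; have ne : (d, p, q) != (d', z, w).
  by apply: contra_neq EF => -[ed ep eq]; rewrite EE FF ed ep eq.
have [pz pw qz qw] := crossing_disjoint pq zw ne a01 b01 c0 e.
rewrite EE FF; case: (ltnP p z) => [ltpz|].
  exact: crossing_pair_mem pq qn zw wn ltpz qz qw a01 b01 c0 e.
(* Exchanging the two edges inverts the factor [c]. *)
rewrite leq_eqVlt eq_sym (negbTE pz) /= => zp; rewrite finset.setUC.
apply: (crossing_pair_mem zw wn pq qn zp _ _ b01 a01 (_ : 0 < c^-1)).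
- by rewrite eq_sym.
- by rewrite eq_sym.
- by rewrite invr_gt0.
by move=> k /e ->; rewrite mulKf // gt_eqF.
Qed.

Lemma meet_unique (E F : {set V}) P P' :
  E \in edges G -> F \in edges G -> E != F ->
  (@draw_arc R n E @` `]0, 1[ `&` @draw_arc R n F @` `]0, 1[) P ->
  (@draw_arc R n E @` `]0, 1[ `&` @draw_arc R n F @` `]0, 1[) P' -> P = P'.
Proof.
move=> EG FG EF [[t t01 tP] [s s01 sP]] [[t' t01' tP'] [s' s01' sP']].
have [c c0] := stereo_inj (segment_off_axis t EG) (segment_off_axis s FG)
  (etrans tP (esym sP)).
have [c' c0'] := stereo_inj (segment_off_axis t' EG) (segment_off_axis s' FG)
  (etrans tP' (esym sP')).
rewrite -tP -tP' /draw_arc.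
have [d [p [q [pq qn EE oE]]]] := edge_orientation EG.
have [d' [z [w [zw wn FF oF]]]] := edge_orientation FG.
have [a a01 ->] := oE t t01; have [a' a01' ->] := oE t' t01'.
have [b b01 ->] := oF s s01; have [b' b01' ->] := oF s' s01'.
move=> e' e; have ne : (d, p, q) != (d', z, w).
  by apply: contra_neq EF => -[ed ep eq]; rewrite EE FF ed ep eq.
have [pz pw _ _] := crossing_disjoint pq zw ne a01 b01 c0 e.
by rewrite (crossing_unique pz pw e e').
Qed.

End Crossings.

Theorem theorem2p1 (R : realType) (n : nat) (hn : (1 <= n)%N) :
  (crossing_number R (Knn_minus_nK2 n) <=
     n %/ 2 * ((n - 1) %/ 2) * ((n - 2) %/ 2) * ((n - 3) %/ 2))%N.
Proof.
(* Two arcs meet at most once, so a crossing is determined by its pair of edges and [fst] is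
   injective on crossings. *)
have [|x [E [F [EG FG EF -> EFx]]]|k kn Dk] := @card_eq_II_seq _ _
    (crossings (antipodal_drawing R n)) fst (crossing_pairs n).
- move=> [S P] [S' P'] /set_mem[E [F [EG FG EF /= -> EFP]]].
  move=> /set_mem[E' [F' [_ _ _ /= -> EFP']]] /= eq2; congr pair => //.
  apply: (meet_unique EG FG EF EFP).
  have : E \in [set E'; F']%SET by rewrite -eq2 !inE eqxx.
  have : F \in [set E'; F']%SET by rewrite -eq2 !inE eqxx orbT.
  rewrite !inE => /orP[] /eqP eF /orP[] /eqP eE; move: EF;
    rewrite eE eF ?eqxx // => _ //.
  by case: EFP'.
- exact: meet_pair_mem EG FG EF EFx.
rewrite size_crossing_pairs in kn; apply: leq_trans kn.
rewrite /crossing_number; case: ex_minnP => m _; apply.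
by apply/asboolP; exists (antipodal_drawing R n).
Qed.
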